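(* Let $A$ be a Cayley--Dickson algebra over a field $F$, let $f(x)\in A[x]$ be either linear (i.e. $f(x)=ax+b$ with $a,b\in A$) or monic quadratic (i.e. $f(x)=x^2+ax+b$ with $a,b\in A$), and let $\lambda\in A$. Then $\lambda$ is a root of $f(x)$ if and only if there exists $g(x)\in A[x]$ such that $f(x)=g(x)\cdot (x-\lambda)$.
   Context: Algebras are unital but not necessarily commutative or associative. Given an $F$-algebra $A$ with involution $q\mapsto\overline{q}$ and $\gamma\in F^\times$, its Cayley--Dickson double is $A\{\gamma\}=A\oplus A\ell$ with product $(q+r\ell)(s+t\ell)=qs+\gamma\overline{t}r+(tq+r\overline{s})\ell$ for $q,r,s,t\in A$, and involution $\overline{q+r\ell}=\overline{q}-r\ell$. A Cayley--Dickson algebra over $F$ is an algebra obtained by repeating this doubling several times (with arbitrary choices of $\gamma\in F^\times$ at each step), starting with a quadratic separable extension $K$ of $F$ with its unique non-trivial automorphism of order $2$ acting trivially on $F$ as the involution. The polynomial algebra is $A[x]=A\otimes_F F[x]$, so $x$ commutes and associates with everything, and every $f(x)\in A[x]$ can be written $f(x)=c_nx^n+\dots+c_1x+c_0$ with $c_i\in A$. For $\lambda\in A$, the substitution is $f(\lambda)=c_n(\lambda^n)+\dots+c_1\lambda+c_0$ (well defined since Cayley--Dickson algebras are power-associative). An element $\lambda\in A$ is a root of $f(x)$ if $f(\lambda)=0$. *)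

(* Defs.v *)
From HB Require Import structures.
From mathcomp Require Import all_boot all_order all_algebra all_fingroup all_field.
From mathcomp Require Import finmap monalg.

Set Implicit Arguments.
Unset Strict Implicit.
Unset Printing Implicit Defensive.

Import GRing.Theory.

Local Open Scope ring_scope.

Reserved Notation "x ** y" (at level 40, left associativity).

(* Unital, not necessarily commutative or associative F-algebras.  MathComp's
   ring multiplication is associative, so the product and the unit are those of
   a unitary magma; ** is that product, usable in ring_scope. *)
Notation "x ** y" := (x%R * y%R)%g : ring_scope.

HB.mixin Record isNaAlgebra (F : fieldType) A of UMagma A & GRing.Lmodule F A := {
  namulDl : forall x y z : A, (x + y) ** z = x ** z + y ** z;
  namulDr : forall x y z : A, x ** (y + z) = x ** y + x ** z;
  nascaleAl : forall (k : F) (x y : A), k *: (x ** y) = (k *: x) ** y;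
  nascaleAr : forall (k : F) (x y : A), k *: (x ** y) = x ** (k *: y)
}.

#[short(type="naAlgType")]
HB.structure Definition NaAlgebra (F : fieldType) :=
  {A of isNaAlgebra F A & UMagma A & GRing.Lmodule F A}.

HB.mixin Record hasInvolution (F : fieldType) A of NaAlgebra F A := {
  bar : A -> A;
  barD : forall x y : A, bar (x + y) = bar x + bar y;
  barZ : forall (k : F) (x : A), bar (k *: x) = k *: bar x;
  barM : forall x y : A, bar (x ** y) = bar y ** bar x;
  barK : involutive bar
}.

#[short(type="naInvAlgType")]
HB.structure Definition NaInvAlgebra (F : fieldType) :=
  {A of hasInvolution F A & NaAlgebra F A}.

Section NaAlgebraTheory.
Variables (F : fieldType) (A : naAlgType F).
Implicit Types x y : A.

Lemma namul0x x : 0 ** x = 0 :> A.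
Proof. by apply: (addrI (0 ** x)); rewrite -namulDl !addr0. Qed.

Lemma namulx0 x : x ** 0 = 0 :> A.
Proof. by apply: (addrI (x ** 0)); rewrite -namulDr !addr0. Qed.

Lemma namulNx x y : (- x) ** y = - (x ** y).
Proof. by apply: (addrI (x ** y)); rewrite -namulDl !subrr namul0x. Qed.

Lemma namulxN x y : x ** (- y) = - (x ** y).
Proof. by apply: (addrI (x ** y)); rewrite -namulDr !subrr namulx0. Qed.
End NaAlgebraTheory.

Section NaInvAlgebraTheory.
Variables (F : fieldType) (A : naInvAlgType F).
Implicit Types x y : A.

Lemma bar0 : bar (0 : A) = 0.
Proof. by apply: (addrI (bar 0)); rewrite -barD !addr0. Qed.

Lemma barN x : bar (- x) = - bar x.
Proof. by apply: (addrI (bar x)); rewrite -barD !subrr bar0. Qed.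

Lemma bar1 : bar (1%g : A) = 1%g.
Proof. by rewrite -[RHS]barK -[bar 1%g]mul1g barM !barK mul1g. Qed.
End NaInvAlgebraTheory.

Section InvField.
Variables (F : fieldType) (K : fieldExtType F) (sigma : {lrmorphism K -> K}).
Hypothesis sigmaK : involutive sigma.

Definition inv_field of involutive sigma : Type := K.
Local Notation B := (inv_field sigmaK).

HB.instance Definition _ := GRing.Lmodule.copy B K.
HB.instance Definition _ := hasMul.Build B (@GRing.mul K).
HB.instance Definition _ := Magma_isUMagma.Build B (@mul1r K) (@mulr1 K).

Fact inv_field_scaleAl (k : F) (x y : B) : k *: (x ** y) = (k *: x) ** y.
Proof. exact: (@scalerAl F K). Qed.
Fact inv_field_scaleAr (k : F) (x y : B) : k *: (x ** y) = x ** (k *: y).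
Proof. exact: (@scalerAr F K). Qed.

HB.instance Definition _ := isNaAlgebra.Build F B
  (@mulrDl K) (@mulrDr K) inv_field_scaleAl inv_field_scaleAr.

Fact inv_field_barD (x y : B) : sigma (x + y) = sigma x + sigma y :> B.
Proof. exact: rmorphD. Qed.
Fact inv_field_barZ (k : F) (x : B) : sigma (k *: x) = k *: (sigma x : B) :> B.
Proof. exact: linearZ. Qed.
Fact inv_field_barM (x y : B) :
  sigma (x ** y) = ((sigma y : B) ** (sigma x : B)) :> B.
Proof. by rewrite [LHS](@rmorphM _ _ sigma) [LHS]mulrC. Qed.

HB.instance Definition _ := hasInvolution.Build F B
  inv_field_barD inv_field_barZ inv_field_barM sigmaK.
End InvField.

(* The pair (q, r) stands for q + r l. *)
Section Double.
Variables (F : fieldType) (A : naInvAlgType F) (gamma : F).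

Definition cd_double of F : Type := (A * A)%type.
Local Notation D := (cd_double gamma).

HB.instance Definition _ := GRing.Lmodule.copy D (A * A)%type.

Definition cd_mul (u v : D) : D :=
  let: (q, r) := u in let: (s, t) := v in
  (q ** s + gamma *: (bar t ** r), t ** q + r ** bar s).
Definition cd_one : D := (1%g, 0).
Definition cd_bar (u : D) : D := (bar u.1, - u.2).

HB.instance Definition _ := hasMul.Build D cd_mul.

Fact cd_mul1 : left_id cd_one cd_mul.
Proof.
by case=> s t; rewrite /cd_mul /= mul1g namulx0 scaler0 addr0 mulg1 namul0x addr0.
Qed.
Fact cd_mulr1 : right_id cd_one cd_mul.
Proof.
case=> q r; rewrite /cd_mul /= mulg1 bar0 namul0x scaler0 addr0 namul0x.
by rewrite bar1 mulg1 add0r.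
Qed.
HB.instance Definition _ := Magma_isUMagma.Build D cd_mul1 cd_mulr1.

Fact cd_mulDl : left_distributive (fun u v : D => u ** v) +%R.
Proof.
move=> [q r] [q' r'] [s t]; congr pair => /=.
  by rewrite namulDl namulDr scalerDr addrACA.
by rewrite namulDl namulDr addrACA.
Qed.
Fact cd_mulDr : right_distributive (fun u v : D => u ** v) +%R.
Proof.
move=> [q r] [s t] [s' t']; congr pair => /=.
  by rewrite namulDr barD namulDl scalerDr addrACA.
by rewrite namulDl barD namulDr addrACA.
Qed.
Fact cd_scaleAl (k : F) (u v : D) : k *: (u ** v) = (k *: u) ** v.
Proof.
case: u v => [q r] [s t]; congr pair => /=; rewrite scalerDr.
  by rewrite nascaleAl -nascaleAr !scalerA [k * _]mulrC.
by rewrite nascaleAr nascaleAl.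
Qed.
Fact cd_scaleAr (k : F) (u v : D) : k *: (u ** v) = u ** (k *: v).
Proof.
case: u v => [q r] [s t]; congr pair => /=; rewrite scalerDr !barZ.
  by rewrite nascaleAr -nascaleAl !scalerA [k * _]mulrC.
by rewrite nascaleAl nascaleAr.
Qed.
HB.instance Definition _ := isNaAlgebra.Build F D
  cd_mulDl cd_mulDr cd_scaleAl cd_scaleAr.

Fact cd_barD (u v : D) : cd_bar (u + v) = cd_bar u + cd_bar v.
Proof. by rewrite /cd_bar /= barD opprD. Qed.
Fact cd_barZ (k : F) (u : D) : cd_bar (k *: u) = k *: cd_bar u.
Proof. by rewrite /cd_bar /= barZ -scalerN. Qed.
Fact cd_barM (u v : D) : cd_bar (u ** v) = cd_bar v ** cd_bar u.
Proof.
case: u v => [q r] [s t]; congr pair => /=.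
  by rewrite barD barZ !barM !barK barN namulNx namulxN opprK.
by rewrite barK !namulNx opprD addrC.
Qed.
Fact cd_barK : involutive cd_bar.
Proof. by case=> q r; rewrite /cd_bar /= barK opprK. Qed.
HB.instance Definition _ := hasInvolution.Build F D cd_barD cd_barZ cd_barM cd_barK.
End Double.

(* The last constructor makes the notion invariant under isomorphism of
   algebras with involution. *)
Inductive CayleyDickson (F : fieldType) : naInvAlgType F -> Prop :=
| CD_quadratic (K : fieldExtType F) (sigma : {lrmorphism K -> K})
    (sigmaK : involutive sigma) :
    \dim {:K} = 2%N -> separable 1 {:K} -> (exists x : K, sigma x != x) ->
    CayleyDickson (inv_field sigmaK)
| CD_double (A : naInvAlgType F) (gamma : F) :
    gamma != 0 -> CayleyDickson A -> CayleyDickson (cd_double A gamma)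
| CD_iso (A B : naInvAlgType F) (phi : {linear A -> B}) :
    bijective phi -> (forall x y : A, phi (x ** y) = phi x ** phi y) ->
    (forall x : A, phi (bar x) = bar (phi x)) ->
    CayleyDickson A -> CayleyDickson B.

(* {poly A} requires an associative A.  A (x)_F F[x] is encoded as the finitely
   supported families (c_n) of elements of A: << c *g n >> is c (x) x^n, and
   napoly_mulUU below is (c (x) x^i) (d (x) x^j) = cd (x) x^(i + j). *)
Section NaPoly.
Variables (F : fieldType) (A : naAlgType F).

Definition napoly : Type := {malg A[nat]}.

HB.instance Definition _ := GRing.Zmodule.copy napoly {malg A[nat]}.
Implicit Types (p q : napoly) (a b : A).

Definition napoly_scale (k : F) p : napoly :=
  \sum_(i <- msupp p) << k *: p@_i *g i >>.

Definition napoly_mul p q : napoly :=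
  \sum_(i <- msupp p) \sum_(j <- msupp q) << p@_i ** q@_j *g (i + j)%N >>.

Definition napolyC a : napoly := << a *g 0%N >>.
Definition napolyX : napoly := << 1%g *g 1%N >>.

Lemma napoly_mulEw (d d' : {fset nat}) p q :
  (msupp p `<=` d)%fset -> (msupp q `<=` d')%fset ->
  napoly_mul p q =
    \sum_(i <- d) \sum_(j <- d') << p@_i ** q@_j *g (i + j)%N >>.
Proof.
move=> sd sd'; rewrite /napoly_mul (big_fset_incl _ sd) /=; last first.
  move=> i _ /mcoeff_outdom pi; apply: big1 => j _.
  by rewrite pi namul0x monalgU0.
apply: eq_bigr => i _; rewrite (big_fset_incl _ sd') //= => j _ /mcoeff_outdom qj.
by rewrite qj namulx0 monalgU0.
Qed.

Lemma napoly_scaleE k p i : (napoly_scale k p)@_i = k *: p@_i.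
Proof.
rewrite raddf_sum /=; have [ip|ip] := msuppP.
  rewrite (big_fsetD1 i) //= mcoeffUU big1_fset ?addr0 // => j.
  by rewrite in_fsetD1 mcoeffU; case: eqP.
rewrite scaler0 big1_fset // => j jp _; rewrite mcoeffU.
by case: eqP => // e; rewrite -e jp in ip.
Qed.

Fact napoly_scaleA k l p : napoly_scale k (napoly_scale l p) = napoly_scale (k * l) p.
Proof. by apply/malgP=> i; rewrite !napoly_scaleE scalerA. Qed.
Fact napoly_scale1 : left_id 1 napoly_scale.
Proof. by move=> p; apply/malgP=> i; rewrite !napoly_scaleE scale1r. Qed.
Fact napoly_scaleDr : right_distributive napoly_scale +%R.
Proof.
by move=> k p q; apply/malgP=> i; rewrite mcoeffD !napoly_scaleE mcoeffD scalerDr.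
Qed.
Fact napoly_scaleDl p : {morph napoly_scale^~ p : k l / k + l}.
Proof. by move=> k l; apply/malgP=> i; rewrite mcoeffD !napoly_scaleE scalerDl. Qed.

HB.instance Definition _ := GRing.Zmodule_isLmodule.Build F napoly
  napoly_scaleA napoly_scale1 napoly_scaleDr napoly_scaleDl.

HB.instance Definition _ := hasMul.Build napoly napoly_mul.

Lemma napoly_mulUU a b i j :
  napoly_mul << a *g i >> << b *g j >> = << a ** b *g (i + j)%N >>.
Proof.
by rewrite (napoly_mulEw msuppU_le msuppU_le) !big_seq_fset1 !mcoeffUU.
Qed.

Fact napoly_mulDl : left_distributive napoly_mul +%R.
Proof.
move=> p q r; pose d := (msupp p `|` msupp q)%fset.
rewrite (napoly_mulEw (d := d) (d' := msupp r)) ?msuppD_le //.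
rewrite (napoly_mulEw (p := p) (d := d) (d' := msupp r)) ?fsubsetUl //.
rewrite (napoly_mulEw (p := q) (d := d) (d' := msupp r)) ?fsubsetUr //.
rewrite -big_split /=; apply: eq_bigr => i _; rewrite -big_split /=.
by apply: eq_bigr => j _; rewrite mcoeffD namulDl monalgUD.
Qed.
Fact napoly_mulDr : right_distributive napoly_mul +%R.
Proof.
move=> r p q; pose d := (msupp p `|` msupp q)%fset.
rewrite (napoly_mulEw (d := msupp r) (d' := d)) ?msuppD_le //.
rewrite (napoly_mulEw (q := p) (d := msupp r) (d' := d)) ?fsubsetUl //.
rewrite (napoly_mulEw (q := q) (d := msupp r) (d' := d)) ?fsubsetUr //.
rewrite -big_split /=; apply: eq_bigr => i _; rewrite -big_split /=.
by apply: eq_bigr => j _; rewrite mcoeffD namulDr monalgUD.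
Qed.

Fact napoly_mul1 : left_id (napolyC 1%g) napoly_mul.
Proof.
move=> p; rewrite (napoly_mulEw msuppU_le (fsubset_refl _)) big_seq_fset1.
rewrite mcoeffUU [RHS](monalgEw (fsubset_refl _)).
by apply: eq_bigr => i _; rewrite mul1g.
Qed.
Fact napoly_mulr1 : right_id (napolyC 1%g) napoly_mul.
Proof.
move=> p; rewrite (napoly_mulEw (fsubset_refl _) msuppU_le).
rewrite [RHS](monalgEw (fsubset_refl _)).
by apply: eq_bigr => i _; rewrite big_seq_fset1 mcoeffUU mulg1 addn0.
Qed.
HB.instance Definition _ := Magma_isUMagma.Build napoly napoly_mul1 napoly_mulr1.

Lemma msupp_scale_le k p : (msupp (k *: p) `<=` msupp p)%fset.
Proof.
apply/fsubsetP=> i; rewrite -!mcoeff_neq0 napoly_scaleE.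
by apply: contraNneq => ->; rewrite scaler0.
Qed.

Lemma napoly_scaleU k a i : k *: (<< a *g i >> : napoly) = << k *: a *g i >>.
Proof.
apply/malgP=> j; rewrite napoly_scaleE !mcoeffU.
by case: eqP; rewrite ?scaler0.
Qed.

Fact napoly_scaleAl k p q : k *: (p ** q) = (k *: p) ** q.
Proof.
rewrite [RHS](napoly_mulEw (msupp_scale_le k p) (fsubset_refl _)).
rewrite [LHS]scaler_sumr; apply: eq_bigr => i _.
rewrite scaler_sumr; apply: eq_bigr => j _.
by rewrite napoly_scaleU napoly_scaleE nascaleAl.
Qed.
Fact napoly_scaleAr k p q : k *: (p ** q) = p ** (k *: q).
Proof.
rewrite [RHS](napoly_mulEw (fsubset_refl _) (msupp_scale_le k q)).
rewrite [LHS]scaler_sumr; apply: eq_bigr => i _.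
rewrite scaler_sumr; apply: eq_bigr => j _.
by rewrite napoly_scaleU napoly_scaleE nascaleAr.
Qed.
HB.instance Definition _ := isNaAlgebra.Build F napoly
  napoly_mulDl napoly_mulDr napoly_scaleAl napoly_scaleAr.

(* In group_scope a ^+ n is a * (a * (... * a)), for any unitary magma. *)
Definition nahorner p a : A := \sum_(n <- msupp p) p@_n ** (a ^+ n)%g.

Definition naroot p a : bool := nahorner p a == 0.
End NaPoly.

Arguments napolyX {F A}.

Notation "a %:NP" := (napolyC a)
  (at level 2, left associativity, format "a %:NP") : ring_scope.

(* Main.v *)
(** Comparing coefficients in [f = g (x - lambda)] gives [f_0 = - g_0 lambda] and
    [f_(n+1) = g_n - g_(n+1) lambda].  As [g] has finitely many coefficients,
    [deg f <= 2] forces [deg g <= 1], so that for [f = e x^2 + a x + b] the only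
    candidate is [g = e x + (a + e lambda)], and it works if and only if
    [b = - (a lambda + (e lambda) lambda)].  This says [f(lambda) = 0] as soon as
    [(e lambda) lambda = e (lambda lambda)], which is clear for [e = 0] and for
    [e = 1]. *)
Require Import Defs.
From HB Require Import structures.
From mathcomp Require Import all_boot all_order all_algebra all_fingroup all_field.
From mathcomp Require Import finmap monalg.

Set Implicit Arguments.
Unset Strict Implicit.
Unset Printing Implicit Defensive.

Import GRing.Theory.

Local Open Scope ring_scope.

Section RightDivision.
Variables (F : fieldType) (A : naAlgType F).
Implicit Types (p q g : napoly A) (a b c e lam : A).

(** Indices outside the support contribute [0 ** _ = 0]. Evaluations of polynomials with different
    supports can thus be summed over one common index set. *)
Lemma nahornerEw (d : {fset nat}) p a : (msupp p `<=` d)%fset ->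
  nahorner p a = \sum_(n <- d) p@_n ** (a ^+ n)%g.
Proof.
move=> sd; rewrite /nahorner (big_fset_incl _ sd) //= => n _ /mcoeff_outdom pn.
by rewrite pn namul0x.
Qed.

Lemma nahornerD p q a : nahorner (p + q) a = nahorner p a + nahorner q a.
Proof.
pose d := (msupp p `|` msupp q)%fset.
rewrite (nahornerEw (d := d)) ?msuppD_le // (nahornerEw (p := p) (d := d)) ?fsubsetUl //.
rewrite (nahornerEw (p := q) (d := d)) ?fsubsetUr // -big_split /=.
by apply: eq_bigr => n _; rewrite mcoeffD namulDl.
Qed.

Lemma nahornerU c n a : nahorner (<< c *g n >> : napoly A) a = c ** (a ^+ n)%g.
Proof. by rewrite (nahornerEw _ msuppU_le) big_seq_fset1 mcoeffUU. Qed.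

Lemma mcoeff_mulU p c k n :
  (p ** (<< c *g k >> : napoly A))@_n = if (k <= n)%N then p@_(n - k)%N ** c else 0.
Proof.
rewrite [_ ** _](napoly_mulEw (fsubset_refl _) msuppU_le) raddf_sum /=.
under eq_bigr => i _ do rewrite big_seq_fset1 mcoeffUU mcoeffU.
case: leqP => [lekn|ltnk]; last first.
  by apply: big1 => i _; case: eqP => // e; rewrite -e ltnNge leq_addl in ltnk.
(* Only the index [n - k] can contribute; if it lies outside the support, both sides vanish. *)
have [ip|ip] := msuppP.
  rewrite (big_fsetD1 (n - k)%N) //= subnK // eqxx big1_fset ?addr0 // => j.
  rewrite in_fsetD1 => /andP[/eqP jn _] _; case: eqP => // e.
  by case: jn; rewrite -e addnK.
rewrite namul0x big1_fset // => j jp _; case: eqP => // e.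
by rewrite -e addnK jp in ip.
Qed.

Lemma mcoeff_mulXsubC0 g lam : (g ** (napolyX - lam%:NP))@_0%N = - (g@_0%N ** lam).
Proof. by rewrite namulDr namulxN mcoeffB !mcoeff_mulU add0r. Qed.

Lemma mcoeff_mulXsubCS g lam n :
  (g ** (napolyX - lam%:NP))@_n.+1 = g@_n - g@_n.+1 ** lam.
Proof. by rewrite namulDr namulxN mcoeffB !mcoeff_mulU /= subn1 subn0 mulg1. Qed.

Lemma mcoeff_eventually0 p : exists N, forall n, (N <= n)%N -> p@_n = 0.
Proof.
exists (\max_(i <- msupp p) i).+1 => n; apply: contraTeq.
by rewrite mcoeff_neq0 -leqNgt => np; apply: leq_bigmax_seq.
Qed.

(** Where the product has zero coefficient at [n.+1], [g@_n = g@_n.+1 ** lam], so vanishing passes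
    from [n.+1] down to [n]; it starts beyond the support of [g]. *)
Lemma mulXsubC_degree g lam k :
    (forall n, (k < n)%N -> (g ** (napolyX - lam%:NP))@_n = 0) ->
  forall n, (k <= n)%N -> g@_n = 0.
Proof.
move=> f0 n; have [N gN] := mcoeff_eventually0 g.
(* The descent is an induction on a bound [d] for the distance from [n] up to [N]. *)
have [d] : exists d, (N <= n + d)%N by exists N; apply: leq_addl.
elim: d n => [|d IHd] n leN len; first by apply: gN; rewrite -(addn0 n).
have gS : g@_n.+1 = 0 by apply: IHd; rewrite ?addSnnS // leqW.
by rewrite -[RHS](f0 n.+1) // mcoeff_mulXsubCS gS namul0x subr0.
Qed.

(** A free leading coefficient [e] treats both shapes of [f] at once. The hypothesis reconciles
    substitution, which yields [e ** (lam ** lam)], with division, which yields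
    [(e ** lam) ** lam]. *)
Lemma naroot_quadratic_mulXsubC e a b lam :
    (e ** lam) ** lam = e ** (lam ** lam) ->
  let f : napoly A := << e *g 2%N >> + << a *g 1%N >> + << b *g 0%N >> in
  naroot f lam <-> exists g : napoly A, f = g ** (napolyX - lam%:NP).
Proof.
move=> assoc_e f.
have fE n : f@_n = if n is 0 then b else if n is 1 then a else if n is 2 then e else 0.
  by rewrite !mcoeffD !mcoeffU; case: n => [|[|[|n]]]; rewrite ?add0r ?addr0.
have fE_lam : nahorner f lam = (a + e ** lam) ** lam + b.
  rewrite !nahornerD !nahornerU expg1 expg2 expg0 mulg1.
  by rewrite namulDl assoc_e [e ** _ + _]addrC.
split=> [|[g fg]].
  rewrite /naroot fE_lam addrC addr_eq0 => /eqP bE.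
  exists (<< e *g 1%N >> + << a + e ** lam *g 0%N >>); apply/malgP=> n; rewrite fE.
  case: n => [|n]; first by rewrite mcoeff_mulXsubC0 mcoeffD !mcoeffU add0r.
  rewrite mcoeff_mulXsubCS !mcoeffD !mcoeffU.
  by case: n => [|[|n]]; rewrite ?add0r ?addr0 ?namul0x ?subr0 ?oppr0 ?addrK.
have g0 n : (2 <= n)%N -> g@_n = 0.
  by apply: (mulXsubC_degree (lam := lam)) => -[|[|[|m]]] // _; rewrite -fg fE.
(* Coefficients 2 and 1 of [f] determine [g] from the top down; coefficient 0 is then the root
   condition. *)
have g1 : g@_1%N = e.
  by rewrite -[RHS](fE 2%N) fg mcoeff_mulXsubCS (g0 2%N) // namul0x subr0.
have gc : g@_0%N = a + e ** lam.
  by rewrite -[a](fE 1%N) fg mcoeff_mulXsubCS g1 subrK.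
by rewrite /naroot fE_lam -gc -[b](fE 0%N) fg mcoeff_mulXsubC0 subrr.
Qed.

End RightDivision.

Theorem proposition2p2 (F : fieldType) (A : naInvAlgType F)
    (hA : CayleyDickson A) (f : napoly A)
    (hf : (exists a b : A, f = a%:NP ** napolyX + b%:NP) \/
          (exists a b : A, f = (napolyX ^+ 2)%g + a%:NP ** napolyX + b%:NP))
    (lam : A) :
  naroot f lam <-> exists g : napoly A, f = g ** (napolyX - lam%:NP).
Proof.
have aX (a : A) : a%:NP ** napolyX = << a *g 1%N >> :> napoly A.
  by rewrite [LHS]napoly_mulUU mulg1.
case: hf => -[a [b ->]]; rewrite aX.
  (* A zero term of degree 2 makes the linear case an instance with [e = 0]. *)
  rewrite -[<< a *g _ >>]add0r -(monalgU0 2%N).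
  by apply: naroot_quadratic_mulXsubC; rewrite !namul0x.
have -> : (napolyX ^+ 2)%g = << 1%g *g 2%N >> :> napoly A.
  by rewrite expg2 [LHS]napoly_mulUU mulg1.
by apply: naroot_quadratic_mulXsubC; rewrite !mul1g.
Qed.
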